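(* Let $\varepsilon>0$, let $m_0\in\mathbb{R}^2$, and for each $i\in\mathbb{N}=\{1,2,\ldots\}$ let $p_i\in\mathbb{R}^2$ be a point with $p_i\neq m_0$. Consider the game in the Euclidean plane in which a man able to run at speed $1+\varepsilon$ starts at $m_0$ and, for each $i\in\mathbb{N}$, a unit speed lion $l_i$ starts at $p_i$. Then the man has a winning strategy against these infinitely many lions.
   Context: All norms are Euclidean. A man path is a function $m\colon[0,\infty)\to\mathbb{R}^2$ with $m(0)=m_0$ and $\|m(s)-m(t)\|\le(1+\varepsilon)|s-t|$ for all $s,t\ge 0$; let $\mathcal{M}$ be the set of man paths. A path of lion $i$ is a function $l\colon[0,\infty)\to\mathbb{R}^2$ with $l(0)=p_i$ and $\|l(s)-l(t)\|\le|s-t|$ for all $s,t\ge0$; let $\mathcal{L}_i$ be the set of such paths. A strategy for the man against the lions $(l_i)_{i\in\mathbb{N}}$ is a function $M\colon\prod_{i\in\mathbb{N}}\mathcal{L}_i\to\mathcal{M}$ that is non-anticipating: for every $t\ge 0$, if $(l_i)_{i}$ and $(l_i')_{i}$ in $\prod_i\mathcal{L}_i$ are such that $l_i$ and $l_i'$ agree on $[0,t)$ for every $i$, then $M((l_i)_i)$ and $M((l_i')_i)$ agree on $[0,t]$. A strategy $M$ for the man is winning if for all $(l_i)_i\in\prod_i\mathcal{L}_i$, all $t\in[0,\infty)$ and all $i\in\mathbb{N}$, we have $M((l_j)_j)(t)\neq l_i(t)$. *)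

(* Defs.v *)
From Stdlib Require Import Reals.
From Coquelicot Require Import Coquelicot.

Set Implicit Arguments.

Open Scope R_scope.

(* The norm of the product normed module is the Euclidean one, see
   [plane_norm_euclidean]. *)
Definition plane : NormedModule R_AbsRing :=
  prod_NormedModule R_AbsRing R_NormedModule R_NormedModule.

Lemma plane_norm_euclidean (x y : R) :
  norm ((x, y) : plane) = sqrt (x ^ 2 + y ^ 2).
Proof.
  change (sqrt (Rabs x ^ 2 + Rabs y ^ 2) = sqrt (x ^ 2 + y ^ 2)).
  now rewrite !pow2_abs.
Qed.

Definition time0 : nonnegreal := mknonnegreal 0 (Rle_refl 0).

Record path (v : R) (x : plane) := Path {
  pos :> nonnegreal -> plane;
  path_start : pos time0 = x;
  path_speed : forall s t : nonnegreal,
    norm (minus (pos s) (pos t)) <= v * Rabs (s - t)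
}.

Definition man_path (eps : R) (m0 : plane) : Type := path (1 + eps) m0.

Definition lion_path (p : plane) : Type := path 1 p.

(* The half-open/closed asymmetry is intended: the man's position at time [t]
   depends only on the lions' positions at times strictly before [t]. *)
Definition non_anticipating (eps : R) (m0 : plane) (p : nat -> plane)
    (M : (forall i : nat, lion_path (p i)) -> man_path eps m0) : Prop :=
  forall (t : nonnegreal) (l l' : forall i : nat, lion_path (p i)),
    (forall (i : nat) (s : nonnegreal), s < t -> l i s = l' i s) ->
    forall s : nonnegreal, s <= t -> M l s = M l' s.

Arguments non_anticipating {eps m0 p} M.

Record strategy (eps : R) (m0 : plane) (p : nat -> plane) := Strategy {
  response :> (forall i : nat, lion_path (p i)) -> man_path eps m0;
  response_non_anticipating : non_anticipating response
}.

Definition winning (eps : R) (m0 : plane) (p : nat -> plane)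
    (M : strategy eps m0 p) : Prop :=
  forall (l : forall i : nat, lion_path (p i)) (t : nonnegreal) (i : nat),
    M l t <> l i t.

(* Main.v *)
(** Man positions [m_0, m_1, ...] are built successively: [m_0] stands still, and
    [m_(j+1)] follows [m_j] up to a deviation [delta_j], at a slightly larger
    speed, while keeping a distance [c_j > 0] from lion [j].  The [delta_j] for
    [j > i] are chosen small compared with [c_i], so the limit of the [m_j] still
    avoids every lion.

    For the step from [m_j] to [m_(j+1)], time is cut into small units.  The man
    runs straight at his target unless the lion is near and ahead.  In that case he
    starts running directly away from the target and turns by small angles until he
    faces it, in straight runs whose lengths grow geometrically.  The lion, being
    slower, is left behind in each run, and remains behind after a small turn; this
    manoeuvre does not depend on what the lion does and has bounded length.  A long
    final run at the target makes up for the lost ground. *)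

Require Import Defs.
From Stdlib Require Import Reals ZArith Lra Lia List IndefiniteDescription.
From Coquelicot Require Import Coquelicot.
Import ListNotations.
Open Scope R_scope.

(* Euclidean geometry of the plane *)
Declare Scope plane_scope.
Delimit Scope plane_scope with P.
Bind Scope plane_scope with plane.
Local Notation "x + y" := (plus (G := plane) x y) : plane_scope.
Local Notation "x - y" := (minus (G := plane) x y) : plane_scope.
Local Notation origin := (zero (G := plane)).
Local Notation "k * x" := (scal (V := plane) k x) : plane_scope.

Local Ltac plane_eq :=
  intros;
  repeat match goal with x : _ |- _ =>
    match type of x with
    | NormedModule.sort _ plane => destruct x as [? ?]
    end end;
  change (NormedModule.sort R_AbsRing R_NormedModule) with R in *;
  apply injective_projections; cbn; unfold mult; simpl;
  match goal with |- ?a = ?b => change (@eq R a b) end; ring.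

Definition dot (x y : plane) : R := fst x * fst y + snd x * snd y.

Lemma norm_dot (x : plane) : norm x = sqrt (dot x x).
Proof.
  destruct x as [a b]. rewrite plane_norm_euclidean. unfold dot. simpl.
  f_equal. ring.
Qed.

Lemma dot_self_ge0 (x : plane) : 0 <= dot x x.
Proof. unfold dot. nra. Qed.

Lemma dot_le_norm (x y : plane) : dot x y <= norm x * norm y.
Proof.
  rewrite !norm_dot, <- sqrt_mult by apply dot_self_ge0.
  apply Rle_trans with (Rabs (dot x y)); [apply Rle_abs|].
  rewrite <- sqrt_Rsqr_abs. apply sqrt_le_1_alt.
  unfold Rsqr, dot.
  (* Lagrange's identity: this square is the gap in the Cauchy-Schwarz inequality. *)
  pose proof (pow2_ge_0 (fst x * snd y - snd x * fst y)). nra.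
Qed.

Lemma dot_plus_l (x y z : plane) : dot (x + y)%P z = dot x z + dot y z.
Proof. unfold dot; cbn; ring. Qed.

Lemma dot_minus_l (x y z : plane) : dot (x - y)%P z = dot x z - dot y z.
Proof. unfold dot; cbn; ring. Qed.

Lemma dot_scal_l (k : R) (x y : plane) : dot (k * x)%P y = k * dot x y.
Proof. unfold dot; cbn; unfold mult; simpl; ring. Qed.

Lemma norm_ge0 (x : plane) : 0 <= norm x.
Proof. exact (norm_ge_0 x). Qed.

Lemma norm_scal_plane (k : R) (x : plane) : norm (k * x)%P = Rabs k * norm x.
Proof.
  rewrite !norm_dot. rewrite <- sqrt_Rsqr_abs, <- sqrt_mult.
  - f_equal. unfold dot, Rsqr; cbn; unfold mult; simpl; ring.
  - apply Rle_0_sqr.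
  - apply dot_self_ge0.
Qed.

Lemma norm_plus_le (x y : plane) : norm (x + y)%P <= norm x + norm y.
Proof. exact (norm_triangle x y). Qed.

Lemma norm_minus_sym (x y : plane) : norm (x - y)%P = norm (y - x)%P.
Proof.
  replace (x - y)%P with ((-1) * (y - x))%P by plane_eq.
  rewrite norm_scal_plane, Rabs_left by lra. ring.
Qed.

Lemma norm_minus_le (x y : plane) : norm (x - y)%P <= norm x + norm y.
Proof.
  replace (x - y)%P with (x + (-1) * y)%P by plane_eq.
  pose proof (norm_plus_le x ((-1) * y)%P) as H.
  rewrite norm_scal_plane, Rabs_left in H by lra. lra.
Qed.

Lemma norm_minus_trans (x y z : plane) :
  norm (x - z)%P <= norm (x - y)%P + norm (y - z)%P.
Proof.
  replace (x - z)%P with ((x - y) + (y - z))%P by plane_eq.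
  apply norm_plus_le.
Qed.

Lemma norm_minus_ge (x y : plane) : norm x - norm y <= norm (x - y)%P.
Proof.
  pose proof (norm_plus_le (x - y)%P y) as H.
  replace (x - y + y)%P with x in H by plane_eq. lra.
Qed.

Lemma norm_plus_ge (x y : plane) : norm x - norm y <= norm (x + y)%P.
Proof.
  pose proof (norm_minus_le (x + y)%P y) as H.
  replace (x + y - y)%P with x in H by plane_eq. lra.
Qed.

Lemma norm_zero_plane : norm origin = 0.
Proof. exact (@norm_zero _ plane). Qed.

Lemma norm_minus_eq0 (x y : plane) : norm (x - y)%P <= 0 -> x = y.
Proof.
  intros H. assert (E : norm (x - y)%P = 0) by (pose proof (norm_ge0 (x - y)%P); lra).
  apply (@norm_eq_zero _ plane) in E.
  replace x with ((x - y) + y)%P by plane_eq. rewrite E. plane_eq.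
Qed.

Lemma norm_minus_self (x : plane) : norm (x - x)%P = 0.
Proof. replace (x - x)%P with origin by plane_eq. apply norm_zero_plane. Qed.

Definition rot (t : R) (e : plane) : plane :=
  (cos t * fst e - sin t * snd e, sin t * fst e + cos t * snd e).

Lemma dot_rot (s t : R) (e : plane) : dot (rot s e) (rot t e) = cos (s - t) * dot e e.
Proof. unfold dot, rot; cbn. rewrite cos_minus. ring. Qed.

Lemma norm_rot (t : R) (e : plane) : norm (rot t e) = norm e.
Proof.
  rewrite !norm_dot, dot_rot. replace (t - t) with 0 by ring. rewrite cos_0.
  f_equal; ring.
Qed.

Lemma dot_unit (e : plane) : norm e = 1 -> dot e e = 1.
Proof.
  rewrite norm_dot. intros H. rewrite <- (sqrt_sqrt (dot e e)) by apply dot_self_ge0.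
  rewrite H. ring.
Qed.

(** * Displacement sequences against an arbitrarily moving point *)

(* [y] is the position of the man relative to a point that moves by at most [s]
   per step while the man performs the displacements [q], each of length at most [w]:
   [G] holds all along and [E] at the end, however the point moves. *)
Fixpoint endures (w s : R) (G E : plane -> Prop) (q : list plane) (y : plane) : Prop :=
  G y /\
  match q with
  | [] => E y
  | u :: q' => norm u <= w /\
      forall b : plane, norm b <= s -> endures w s G E q' (y + u - b)%P
  end.

Lemma endures_here w s G E q y : endures w s G E q y -> G y.
Proof. destruct q; simpl; tauto. Qed.

Lemma endures_impl w s G E E' q y :
  (forall x, E x -> E' x) -> endures w s G E q y -> endures w s G E' q y.
Proof.
  intros H. revert y. induction q as [|u q IH]; simpl; intros y; [firstorder|].
  intros (h1 & h2 & h3). repeat split; auto.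
Qed.

Lemma endures_app w s G E q1 q2 y :
  endures w s G (endures w s G E q2) q1 y -> endures w s G E (q1 ++ q2) y.
Proof.
  revert y. induction q1 as [|u q IH]; simpl; intros y; [tauto|].
  intros (h1 & h2 & h3). repeat split; auto.
Qed.

(** The moves of the point add up to one vector [b], and the equal displacements to a multiple of
    [u], so only totals have to be controlled. *)
Lemma endures_repeat w s G E u n y :
  norm u <= w ->
  (forall i b, (i <= n)%nat -> norm b <= INR i * s -> G (y + INR i * u - b)%P) ->
  (forall b, norm b <= INR n * s -> E (y + INR n * u - b)%P) ->
  endures w s G E (repeat u n) y.
Proof.
  intros hu. revert y. induction n as [|n IH]; intros y HG HE.
  - assert (e : (y + INR 0 * u - origin)%P = y) by plane_eq.
    assert (z : norm origin <= INR 0 * s) by (rewrite norm_zero_plane; simpl; lra).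
    split; rewrite <- e; auto.
  - split; [|split; [exact hu|]].
    + replace y with (y + INR 0 * u - origin)%P by plane_eq. apply HG; [lia|].
      rewrite norm_zero_plane; simpl; lra.
    + intros b hb. apply IH.
      * intros i c hi hc.
        replace (y + u - b + INR i * u - c)%P with (y + INR (S i) * u - (b + c))%P
          by (rewrite S_INR; plane_eq).
        apply HG; [lia|]. rewrite S_INR. pose proof (norm_plus_le b c). lra.
      * intros c hc.
        replace (y + u - b + INR n * u - c)%P with (y + INR (S n) * u - (b + c))%P
          by (rewrite S_INR; plane_eq).
        apply HE. rewrite S_INR. pose proof (norm_plus_le b c). lra.
Qed.

(** Whatever the directions, each step changes the relative position by at most [w + s]. *)
Lemma endures_ball w s G E q y :
  0 <= w -> 0 <= s ->
  (forall u, In u q -> norm u <= w) ->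
  (forall x, norm x <= (w + s) * INR (length q) -> G (y + x)%P) ->
  (forall x, norm x <= (w + s) * INR (length q) -> E (y + x)%P) ->
  endures w s G E q y.
Proof.
  intros hw hs. revert y. induction q as [|u q IH]; intros y hq HG HE.
  - assert (e : (y + origin)%P = y) by plane_eq.
    assert (z : norm origin <= (w + s) * INR (length (@nil plane)))
      by (rewrite norm_zero_plane; simpl; lra).
    split; rewrite <- e; auto.
  - assert (hl : INR (length (u :: q)) = INR (length q) + 1)
      by (rewrite <- S_INR; reflexivity).
    rewrite hl in HG, HE. pose proof (pos_INR (length q)).
    assert (hu : norm u <= w) by (apply hq; left; reflexivity).
    split; [|split; [exact hu|]].
    + replace y with (y + origin)%P by plane_eq. apply HG. rewrite norm_zero_plane.
      apply Rmult_le_pos; lra.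
    + intros b hb.
      assert (K : forall x, norm x <= (w + s) * INR (length q) ->
        norm (u - b + x)%P <= (w + s) * (INR (length q) + 1)).
      { intros x hx. pose proof (norm_plus_le (u - b)%P x). pose proof (norm_minus_le u b). nra. }
      apply IH.
      * intros v hv; apply hq; right; exact hv.
      * intros x hx. replace (y + u - b + x)%P with (y + (u - b + x))%P by plane_eq.
        apply HG, K, hx.
      * intros x hx. replace (y + u - b + x)%P with (y + (u - b + x))%P by plane_eq.
        apply HE, K, hx.
Qed.

(** * The turning manoeuvre around a lion *)

Lemma dot_rot_PI (y e : plane) : dot y (rot PI e) = - dot y e.
Proof. unfold dot, rot; cbn. rewrite cos_PI, sin_PI. ring. Qed.

Lemma exists_INR_ge (x : R) : exists n : nat, x <= INR n.
Proof.
  destruct (nfloor_ex (Rmax x 0) (Rmax_r _ _)) as [n [_ hn]].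
  exists (S n). rewrite S_INR. pose proof (Rmax_l x 0). lra.
Qed.

(** Here [y] is the man's position relative to the lion, so [0 <= dot y u] puts the lion behind him.
    For the new distance [X], adding [(w - 1) * t <= X] and [r - (w + 1) * t <= X] with weights
    [w + 1] and [w - 1] eliminates [t]. *)
Lemma run_away (w r t : R) (u y b : plane) :
  1 < w -> norm u = 1 -> r <= norm y -> 0 <= dot y u -> 0 <= t -> norm b <= t ->
  (w - 1) * r <= 2 * w * norm (y + t * (w * u) - b)%P /\
  (w - 1) * t <= dot (y + t * (w * u) - b)%P u.
Proof.
  intros hw hu hy hd ht hb.
  assert (h : (w - 1) * t <= dot (y + t * (w * u) - b)%P u).
  { rewrite dot_minus_l, dot_plus_l, !dot_scal_l, (dot_unit _ hu).
    pose proof (dot_le_norm b u) as H. rewrite hu in H. nra. }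
  split; [|exact h].
  pose proof (dot_le_norm (y + t * (w * u) - b)%P u) as H1. rewrite hu in H1.
  pose proof (norm_minus_ge (y + t * (w * u))%P b) as H2.
  pose proof (norm_plus_ge y (t * (w * u))%P) as H3.
  rewrite !norm_scal_plane, hu, (Rabs_right t), (Rabs_right w) in H3 by lra.
  set (X := norm (y + t * (w * u) - b)%P) in *.
  assert (h4 : (w - 1) * t <= X) by lra.
  assert (h5 : r - (w + 1) * t <= X) by lra.
  nra.
Qed.

(** After a turn this small, a run at speed [w] still counts for a gain of [(w - 1) / 2] per time
    unit on the lion in the new direction; [S N] such turns make up a half turn. *)
Lemma exists_small_angle (w : R) : 1 < w ->
  exists N : nat, w - 1 <= 2 * (w * cos (PI / INR (S N)) - 1).
Proof.
  intros hw. destruct (exists_INR_ge (16 * w / (w - 1))) as [N hN]. exists N.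
  set (n := INR (S N)).
  assert (hn : 16 * w <= n * (w - 1)).
  { unfold n. rewrite S_INR. apply (Rmult_le_compat_r (w - 1)) in hN; [|lra].
    unfold Rdiv in hN. rewrite Rmult_assoc, Rinv_l in hN by lra. nra. }
  assert (h1 : 1 <= n) by (unfold n; rewrite S_INR; pose proof (pos_INR N); lra).
  set (x := PI / n / 2).
  pose proof PI_RGT_0 as hp. pose proof PI_4 as hp4.
  assert (hx : x * n <= 2) by (unfold x; field_simplify; lra).
  assert (hx0 : 0 < x).
  { unfold x. apply Rdiv_lt_0_compat; [|lra]. apply Rdiv_lt_0_compat; lra. }
  (* By [cos (2 * x) = 1 - 2 * sin x * sin x] the claim becomes
     [4 * w * (sin x * sin x) <= w - 1]. *)
  replace (PI / n) with (2 * x) by (unfold x; field; lra).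
  rewrite cos_2a_sin.
  pose proof (sin_lt_x x hx0) as hs.
  assert (hs0 : 0 <= sin x).
  { apply sin_ge_0; [lra|]. assert (x * 1 <= x * n) by (apply Rmult_le_compat_l; lra).
    pose proof PI2_3_2. unfold PI2 in *. lra. }
  assert (hss : sin x * sin x <= x * x) by nra.
  assert (hxx : x * x * n <= 4).
  { assert (x * 1 <= x * n) by (apply Rmult_le_compat_l; lra). nra. }
  assert (hfin : 16 * w * (x * x) <= 4 * (w - 1)).
  { apply Rle_trans with (n * (w - 1) * (x * x)); [nra|nra]. }
  nra.
Qed.

Lemma repeat_norm (w : R) (u v : plane) (n : nat) :
  0 <= w -> norm u = 1 -> In v (repeat (w * u)%P n) -> norm v <= w.
Proof.
  intros hw hu hv. apply repeat_spec in hv. subst v.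
  rewrite norm_scal_plane, hu, Rabs_right; lra.
Qed.

(* [q] is independent of [y]: the run in direction [rot (k * eta) e] lasts so long
   compared with [P] that the lion is also behind with respect to the next direction. *)
Lemma spiral_exists (w eta c r : R) :
  1 < w -> w - 1 <= 2 * (w * cos eta - 1) -> 0 < r -> 2 * w * c <= (w - 1) * r ->
  forall (k : nat) (P : R), r <= P ->
  exists n : nat, forall e : plane, norm e = 1 ->
  exists q : list plane, (length q <= n)%nat /\ (forall u, In u q -> norm u <= w) /\
  forall y, r <= norm y <= P -> 0 <= dot y (rot (INR k * eta) e) ->
  endures w 1 (fun x => c <= norm x) (fun x => r <= norm x /\ 0 <= dot x e) q y.
Proof.
  intros hw heta hr hc. induction k as [|k IH]; intros P hP.
  - exists 0%nat. intros e he. exists []. split; [reflexivity|]. split; [contradiction|].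
    intros y hy hd.
    replace (rot (INR 0 * eta) e) with e in hd.
    + simpl. split; [nra|lra].
    + simpl INR. rewrite Rmult_0_l. unfold rot. rewrite cos_0, sin_0. plane_eq.
  (* Measured in the next direction, the run gains [INR T * (w * cos eta - 1) >= P], which outweighs
     the lead of at most [P] that the lion may have there. *)
  - destruct (exists_INR_ge (2 * P / (w - 1))) as [T hT].
    assert (hT' : 2 * P <= (w - 1) * INR T).
    { apply (Rmult_le_compat_r (w - 1)) in hT; [|lra].
      unfold Rdiv in hT. rewrite Rmult_assoc, Rinv_l in hT by lra. lra. }
    pose proof (pos_INR T) as hT0.
    (* During the run the distance to the lion grows by at most [w + 1] per step. *)
    destruct (IH (P + (w + 1) * INR T)) as [n hn].
    { assert (0 <= (w + 1) * INR T) by (apply Rmult_le_pos; lra). lra. }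
    exists (T + n)%nat. intros e he. destruct (hn e he) as (q & hq1 & hq2 & hq3).
    set (u := rot (INR (S k) * eta) e).
    assert (hu : norm u = 1) by (unfold u; rewrite norm_rot; exact he).
    exists (repeat (w * u)%P T ++ q). split; [|split].
    + rewrite length_app, repeat_length. apply Nat.add_le_mono_l, hq1.
    + intros v hv. apply in_app_or in hv. destruct hv as [hv|hv]; [|auto].
      apply (repeat_norm _ _ _ _ (Rlt_le _ _ (Rlt_trans _ _ _ Rlt_0_1 hw)) hu hv).
    + intros y hy hd. apply endures_app, endures_repeat.
      * rewrite norm_scal_plane, hu, Rabs_right; lra.
      * intros i b _ hb. rewrite Rmult_1_r in hb.
        destruct (run_away w r (INR i) u y b) as [h _]; try lra; try apply pos_INR.
        apply Rmult_le_reg_l with (2 * w); lra.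
      * intros b hb. rewrite Rmult_1_r in hb.
        destruct (run_away w r (INR T) u y b) as [_ h]; try lra.
        apply hq3; [split|].
        -- pose proof (dot_le_norm (y + INR T * (w * u) - b)%P u) as H.
           rewrite hu in H. lra.
        -- pose proof (norm_minus_le (y + INR T * (w * u))%P b).
           pose proof (norm_plus_le y (INR T * (w * u))%P) as h1.
           rewrite !norm_scal_plane, hu, (Rabs_right w), (Rabs_right (INR T)) in h1 by lra.
           lra.
        -- set (u' := rot (INR k * eta) e).
           assert (hu' : norm u' = 1) by (unfold u'; rewrite norm_rot; exact he).
           assert (huu : dot u u' = cos eta).
           { unfold u, u'. rewrite dot_rot, (dot_unit _ he), S_INR.
             replace ((INR k + 1) * eta - INR k * eta) with eta by ring. ring. }
           rewrite dot_minus_l, dot_plus_l, !dot_scal_l, huu.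
           pose proof (dot_le_norm b u') as H1. rewrite hu' in H1.
           pose proof (dot_le_norm ((-1) * y)%P u') as H2.
           rewrite hu', dot_scal_l, norm_scal_plane, Rabs_left in H2 by lra.
           nra.
Qed.

(** * Plans that return to the target *)

(** With [z] the man's position relative to his target, [e] points at the target; if [z] vanishes,
    any unit vector serves. *)
Lemma unit_direction (z : plane) : exists e : plane, norm e = 1 /\ z = ((- norm z) * e)%P.
Proof.
  destruct (Req_dec (norm z) 0) as [h|h].
  - exists ((1, 0) : plane). split.
    + rewrite plane_norm_euclidean. replace (1 ^ 2 + 0 ^ 2) with 1 by ring. apply sqrt_1.
    + assert (hz : z = origin).
      { apply norm_minus_eq0. replace (z - origin)%P with z by plane_eq. lra. }
      rewrite h, hz. plane_eq.
  - exists ((- / norm z) * z)%P. pose proof (norm_ge0 z).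
    assert (hi : 0 < / norm z) by (apply Rinv_0_lt_compat; lra).
    split.
    + rewrite norm_scal_plane, Rabs_left by lra. field. exact h.
    + set (k := norm z) in *.
      replace ((- k) * ((- / k) * z))%P with ((k * / k)%R * z)%P by plane_eq.
      rewrite Rinv_r by exact h. plane_eq.
Qed.

(* The final run of [T] steps towards the target makes up for the [q1] detour. *)
Lemma catch_up (w v D0 D1 : R) (n T : nat) (e z : plane) (q1 : list plane) :
  0 <= v <= w -> norm e = 1 -> z = ((- norm z) * e)%P -> norm z <= D0 ->
  (length q1 <= n)%nat -> (forall u, In u q1 -> norm u <= w) ->
  (w + v) * INR n <= (w - v) * INR T -> 2 * w * INR T <= D0 ->
  D0 + (w + v) * (INR n + INR T) <= D1 ->
  endures w v (fun x => norm x <= D1) (fun x => norm x <= D0)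
    (q1 ++ repeat (w * e)%P T) z.
Proof.
  intros hv he hz hzD hl hq hT hD0 hD1.
  assert (hl' : (w + v) * INR (length q1) <= (w + v) * INR n).
  { apply Rmult_le_compat_l; [lra|]. apply le_INR, hl. }
  pose proof (pos_INR T) as hT0.
  pose proof (Rmult_le_pos w (INR T)) as hwT. pose proof (Rmult_le_pos v (INR T)) as hvT.
  apply endures_app, endures_ball; try lra; [exact hq| |].
  - intros x hx. pose proof (norm_plus_le z x).
    assert (0 <= (w + v) * INR T) by (apply Rmult_le_pos; lra). lra.
  - intros x hx. apply endures_repeat.
    + rewrite norm_scal_plane, he, Rabs_right; lra.
    + intros i b hi hb. apply le_INR in hi. pose proof (pos_INR i).
      pose proof (norm_minus_le (z + x + INR i * (w * e))%P b).
      pose proof (norm_plus_le (z + x)%P (INR i * (w * e))%P) as h1.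
      rewrite !norm_scal_plane, he, (Rabs_right w), (Rabs_right (INR i)) in h1 by lra.
      pose proof (norm_plus_le z x).
      assert ((w + v) * INR i <= (w + v) * INR T) by (apply Rmult_le_compat_l; lra).
      lra.
    + intros b hb.
      (* Detour and target motion contribute at most [(w + v) * INR n + v * INR T <= w * INR T]. The
         run itself shortens [z] by [w * INR T] or overshoots by at most that, which
         [2 * w * INR T <= D0] allows. *)
      replace (z + x + INR T * (w * e) - b)%P with ((z + INR T * (w * e)) + (x - b))%P
        by plane_eq.
      pose proof (norm_plus_le (z + INR T * (w * e))%P (x - b)%P).
      pose proof (norm_minus_le x b).
      assert (hm : norm (z + INR T * (w * e))%P = Rabs (INR T * w - norm z)).
      { set (d := norm z) in *. rewrite hz.
        replace (- d * e + INR T * (w * e))%P with ((INR T * w - d)%R * e)%P by plane_eq.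
        rewrite norm_scal_plane, he. ring. }
      pose proof (norm_ge0 z). unfold Rabs in hm. destruct (Rcase_abs _) in hm; lra.
Qed.

(** [y] is the position relative to the lion, [z] relative to the target. The bounds reached at the
    end are those assumed at the start, so plans can be chained. *)
Lemma plan_exists (w v : R) : 1 < w -> 0 <= v < w ->
  exists r D0 D1 : R, 0 < r /\ 0 <= D0 /\
  forall y z : plane, r <= norm y -> norm z <= D0 ->
  exists q : list plane, q <> [] /\
  endures w 1 (fun x => 2 * (w + 1) <= norm x) (fun x => r <= norm x) q y /\
  endures w v (fun x => norm x <= D1) (fun x => norm x <= D0) q z.
Proof.
  intros hw hv.
  destruct (exists_small_angle w hw) as [N hN].
  (* [r] solves [(w - 1) * r = 2 * w * c], so [run_away] guarantees exactly the clearance [c]. This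
     is twice what man and lion together cover in a time unit, so interpolation will leave half of
     it. *)
  set (r := 4 * w * (w + 1) / (w - 1)).
  set (c := 2 * (w + 1)).
  assert (hr : (w - 1) * r = 4 * w * (w + 1)) by (unfold r; field; lra).
  assert (hr0 : 0 < r) by nra.
  assert (hrw : w + 1 <= r) by nra.
  assert (hc : 2 * w * c <= (w - 1) * r) by (rewrite hr; unfold c; lra).
  assert (hcr : c <= r) by nra.
  destruct (spiral_exists w _ c r hw hN hr0 hc (S N) (2 * r)) as [n hn]; [lra|].
  (* The final run has to make up for a detour of up to [n] steps, regain the distance [r], and
     contain a step. *)
  destruct (exists_INR_ge (Rmax ((w + v) * INR n / (w - v)) (Rmax (r / (w - 1)) 1)))
    as [T hT].
  pose proof (pos_INR n) as hn0.
  assert (hT1 : (w + v) * INR n <= (w - v) * INR T).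
  { apply Rle_trans with ((w - v) * ((w + v) * INR n / (w - v))).
    - right. field. lra.
    - apply Rmult_le_compat_l; [lra|]. eapply Rle_trans, hT. apply Rmax_l. }
  assert (hT2 : r <= (w - 1) * INR T).
  { apply Rle_trans with ((w - 1) * (r / (w - 1))).
    - right. field. lra.
    - apply Rmult_le_compat_l; [lra|]. eapply Rle_trans, hT.
      eapply Rle_trans, Rmax_r. apply Rmax_l. }
  assert (hT3 : 1 <= INR T).
  { eapply Rle_trans, hT. eapply Rle_trans, Rmax_r. apply Rmax_r. }
  assert (hTn : (1 <= T)%nat) by (apply INR_le; simpl; exact hT3).
  set (D0 := 2 * w * INR T).
  assert (hD0 : 2 * w * 1 <= D0) by (apply Rmult_le_compat_l; lra).
  set (D1 := D0 + (w + v) * (INR n + INR T)).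
  assert (finish : forall e y, norm e = 1 -> r <= norm y -> 0 <= dot y e ->
    endures w 1 (fun x => c <= norm x) (fun x => r <= norm x) (repeat (w * e)%P T) y).
  { intros e y he hy hd. apply endures_repeat.
    - rewrite norm_scal_plane, he, Rabs_right; lra.
    - intros i b _ hb. rewrite Rmult_1_r in hb.
      destruct (run_away w r (INR i) e y b) as [h _]; try lra; try apply pos_INR.
      apply Rmult_le_reg_l with (2 * w); lra.
    - intros b hb. rewrite Rmult_1_r in hb.
      destruct (run_away w r (INR T) e y b) as [_ h]; try lra.
      pose proof (dot_le_norm (y + INR T * (w * e) - b)%P e) as H. rewrite he in H. lra. }
  exists r, D0, D1. split; [exact hr0|]. split; [lra|].
  intros y z hy hz. destruct (unit_direction z) as (e & he & hze).
  destruct (Rle_dec (2 * r) (norm y)) as [far|near];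
    [|destruct (Rle_dec 0 (dot y e)) as [behind|ahead]].
  (* One step loses at most [w + 1 <= r] of a distance of at least [2 * r]. *)
  - exists ([] ++ repeat (w * e)%P 1). split; [discriminate|]. split.
    + simpl. split; [lra|]. split; [rewrite norm_scal_plane, he, Rabs_right; lra|].
      intros b hb. pose proof (norm_minus_ge (y + w * e)%P b).
      pose proof (norm_plus_ge y (w * e)%P) as h.
      rewrite norm_scal_plane, he, Rabs_right in h by lra. lra.
    + apply (catch_up w v D0 D1 0 1 e z []); simpl; try lra; try assumption; try tauto; try lia.
      unfold D1. assert ((w + v) * 1 <= (w + v) * (INR n + INR T))
        by (apply Rmult_le_compat_l; lra). lra.
  - exists ([] ++ repeat (w * e)%P T). split; [destruct T; [lia|discriminate]|]. split.
    + apply finish; assumption.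
    + apply (catch_up w v D0 D1 n T e z []); try assumption; try (unfold D1, D0; lra).
      * simpl. lia.
      * contradiction.
  (* A lion ahead in direction [e] is behind in direction [rot PI e], where the manoeuvre begins. *)
  - destruct (hn e he) as (q & hq1 & hq2 & hq3).
    exists (q ++ repeat (w * e)%P T). split; [destruct q, T; try lia; discriminate|]. split.
    + apply endures_app. eapply endures_impl; [|apply hq3].
      * intros x [h1 h2]. apply finish; assumption.
      * lra.
      * replace (INR (S N) * (PI / INR (S N))) with PI by (field; apply not_0_INR; lia).
        rewrite dot_rot_PI. lra.
    + apply (catch_up w v D0 D1 n T e z q); try assumption; unfold D1, D0; lra.
Qed.

(** * The game in discrete time *)

(* A state consists of the displacements still to be performed and the position; a new
   plan is made only when none are left. *)
Definition next (plan : plane -> plane -> list plane) (a l : plane)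
    (x : list plane * plane) : list plane * plane :=
  let (q, m) := x in
  match (match q with [] => plan (m - l)%P (m - a)%P | _ => q end) with
  | [] => ([], m)
  | u :: q' => (q', (m + u)%P)
  end.

Fixpoint run (plan : plane -> plane -> list plane) (a l : nat -> plane) (n : nat) :
    list plane * plane :=
  match n with
  | O => ([], a O)
  | S k => next plan (a k) (l k) (run plan a l k)
  end.

Lemma run_ext plan (a a' l l' : nat -> plane) (n : nat) :
  a O = a' O -> (forall k, (k < n)%nat -> a k = a' k /\ l k = l' k) ->
  run plan a l n = run plan a' l' n.
Proof.
  intros h0 h. induction n as [|n IH]; simpl.
  - rewrite h0. reflexivity.
  - destruct (h n) as [-> ->]; [lia|]. rewrite IH; [reflexivity|].
    intros k hk. apply h. lia.
Qed.

Lemma discrete_evasion (w v : R) : 1 < w -> 0 <= v < w ->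
  exists (r D : R) (F : (nat -> plane) -> (nat -> plane) -> nat -> plane),
  0 < r /\ 0 <= D /\
  (forall a a' l l' n, a O = a' O ->
    (forall k, (k < n)%nat -> a k = a' k /\ l k = l' k) -> F a l n = F a' l' n) /\
  forall a l,
    (forall n, norm (a (S n) - a n)%P <= v) -> (forall n, norm (l (S n) - l n)%P <= 1) ->
    r <= norm (a O - l O)%P ->
    F a l O = a O /\
    forall n, norm (F a l (S n) - F a l n)%P <= w /\
      norm (F a l n - a n)%P <= D /\ 2 * (w + 1) <= norm (F a l n - l n)%P.
Proof.
  intros hw hv. destruct (plan_exists w v hw hv) as (r & D0 & D1 & hr & hD0 & H).
  (* The specification is conditional, so that [plan] is defined for all pairs; outside the
     admissible region any list will do. *)
  destruct (functional_choice
    (fun (yz : plane * plane) q => r <= norm (fst yz) -> norm (snd yz) <= D0 -> q <> [] /\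
      endures w 1 (fun x => 2 * (w + 1) <= norm x) (fun x => r <= norm x) q (fst yz) /\
      endures w v (fun x => norm x <= D1) (fun x => norm x <= D0) q (snd yz)))
    as [plan hplan].
  { intros [y z]. simpl.
    destruct (Rle_dec r (norm y)) as [h1|h1]; [|exists []; tauto].
    destruct (Rle_dec (norm z) D0) as [h2|h2]; [|exists []; tauto].
    destruct (H y z h1 h2) as [q hq]. exists q. tauto. }
  set (pl := fun y z => plan (y, z)).
  exists r, (Rmax D1 0), (fun a l n => snd (run pl a l n)).
  split; [exact hr|]. split; [apply Rmax_r|]. split.
  { intros a a' l l' n h0 h. rewrite (run_ext pl a a' l l' n h0 h). reflexivity. }
  intros a l ha hl h0. split; [reflexivity|].
  (* Invariant: from the current position, the remaining displacements succeed against lion and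
     target, however these move. *)
  set (good := fun n (x : list plane * plane) =>
    endures w 1 (fun x => 2 * (w + 1) <= norm x) (fun x => r <= norm x)
      (fst x) (snd x - l n)%P /\
    endures w v (fun x => norm x <= D1) (fun x => norm x <= D0) (fst x) (snd x - a n)%P).
  assert (step : forall n x, good n x ->
    norm (snd (next pl (a n) (l n) x) - snd x)%P <= w /\
    good (S n) (next pl (a n) (l n) x)).
  { intros n [q m] hx.
    assert (hu : forall u q', good n (u :: q', m) ->
      norm ((m + u) - m)%P <= w /\ good (S n) (q', (m + u)%P)).
    { intros u q' [(_ & h1 & h2) (_ & _ & h3)]. cbn [fst snd] in h2, h3. split.
      - replace (m + u - m)%P with u by plane_eq. exact h1.
      - split; simpl.
        + replace (m + u - l (S n))%P with ((m - l n) + u - (l (S n) - l n))%P by plane_eq.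
          apply h2, hl.
        + replace (m + u - a (S n))%P with ((m - a n) + u - (a (S n) - a n))%P by plane_eq.
          apply h3, ha. }
    destruct q as [|u q']; [|apply hu, hx].
    destruct hx as [[_ hx1] [_ hx2]]. simpl in hx1, hx2.
    destruct (hplan ((m - l n)%P, (m - a n)%P) hx1 hx2) as (p1 & p2 & p3).
    unfold next, pl. simpl in p2, p3.
    destruct (plan _) as [|u q'] in p1, p2, p3 |- *; [congruence|].
    apply hu. split; assumption. }
  assert (inv : forall n, good n (run pl a l n)).
  { induction n as [|n IH]; [|apply step, IH].
    (* Nothing is left to perform at the start; the bounds there are read off the beginning of the
       plan for this position. *)
    assert (hz : norm (a O - a O)%P <= D0) by (rewrite norm_minus_self; exact hD0).
    destruct (hplan ((a O - l O)%P, (a O - a O)%P) h0 hz) as (_ & p2 & p3).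
    apply endures_here in p2. apply endures_here in p3.
    split; split; assumption. }
  intros n. split; [apply step, inv|]. destruct (inv n) as [i1 i2].
  apply endures_here in i1. apply endures_here in i2. split; [|exact i1].
  eapply Rle_trans; [exact i2|apply Rmax_l].
Qed.

(** * Piecewise linear interpolation *)

Definition nat_floor (t : R) : nat := Z.to_nat (Int_part t).

Lemma nat_floor_spec (t : R) : 0 <= t -> INR (nat_floor t) <= t < INR (nat_floor t) + 1.
Proof.
  intros ht. unfold nat_floor. destruct (base_Int_part t) as [h1 h2].
  assert (hz : (0 <= Int_part t)%Z).
  { assert (-1 < Int_part t)%Z by (apply lt_IZR; lra). lia. }
  rewrite INR_IZR_INZ, Z2Nat.id by exact hz. lra.
Qed.

Definition interpolate (m : nat -> plane) (t : R) : plane :=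
  (m (nat_floor t) + (t - INR (nat_floor t))%R * (m (S (nat_floor t)) - m (nat_floor t)))%P.

Definition lipschitz (k : R) (f : R -> plane) : Prop :=
  forall s t, 0 <= s -> 0 <= t -> norm (f s - f t)%P <= k * Rabs (s - t).

Lemma lipschitz_of_le (k : R) (f : R -> plane) :
  (forall s t, 0 <= s <= t -> norm (f t - f s)%P <= k * (t - s)) -> lipschitz k f.
Proof.
  intros h s t hs ht. destruct (Rle_dec s t) as [hst|hst].
  - rewrite norm_minus_sym, Rabs_minus_sym, Rabs_right by lra. apply h; lra.
  - rewrite Rabs_right by lra. apply h; lra.
Qed.

Lemma interpolate_0 (m : nat -> plane) : interpolate m 0 = m O.
Proof.
  destruct (nat_floor_spec 0) as [h _]; [lra|].
  assert (e : nat_floor 0 = O).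
  { pose proof (pos_INR (nat_floor 0)). apply INR_eq. simpl. lra. }
  unfold interpolate. rewrite e. simpl. replace (0 - 0) with 0 by ring. plane_eq.
Qed.

Lemma steps_le (k : R) (m : nat -> plane) (i j : nat) :
  (forall n, norm (m (S n) - m n)%P <= k) -> (i <= j)%nat ->
  norm (m j - m i)%P <= k * (INR j - INR i).
Proof.
  intros hm h. induction h as [|j hj IH].
  - rewrite norm_minus_self. lra.
  - rewrite S_INR. pose proof (norm_minus_trans (m (S j)) (m j) (m i)).
    specialize (hm j). lra.
Qed.

Lemma interpolate_floor (k : R) (m : nat -> plane) (t : R) :
  (forall n, norm (m (S n) - m n)%P <= k) -> 0 <= t ->
  norm (interpolate m t - m (nat_floor t))%P <= k * (t - INR (nat_floor t)).
Proof.
  intros hm ht. unfold interpolate. pose proof (nat_floor_spec t ht).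
  set (n := nat_floor t) in *. specialize (hm n).
  set (s := t - INR n) in *. set (d := (m (S n) - m n)%P) in *.
  replace (m n + s * d - m n)%P with (s * d)%P by plane_eq.
  rewrite norm_scal_plane, Rabs_right by (unfold s; lra).
  rewrite Rmult_comm. apply Rmult_le_compat_r; [unfold s; lra|exact hm].
Qed.

Lemma interpolate_ceil (k : R) (m : nat -> plane) (t : R) :
  (forall n, norm (m (S n) - m n)%P <= k) -> 0 <= t ->
  norm (m (S (nat_floor t)) - interpolate m t)%P <= k * (INR (S (nat_floor t)) - t).
Proof.
  intros hm ht. unfold interpolate. pose proof (nat_floor_spec t ht). rewrite S_INR.
  set (n := nat_floor t) in *. specialize (hm n).
  set (s := t - INR n) in *.
  replace (m (S n) - (m n + s * (m (S n) - m n)))%P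
    with ((1 - s)%R * (m (S n) - m n))%P by plane_eq.
  rewrite norm_scal_plane, Rabs_right by (unfold s; lra).
  replace (INR n + 1 - t) with (1 - s) by (unfold s; ring).
  rewrite Rmult_comm. apply Rmult_le_compat_r; [unfold s; lra|exact hm].
Qed.

(** Times in different cells are joined through the grid points just after the earlier and just
    before the later one. *)
Lemma interpolate_lipschitz (k : R) (m : nat -> plane) :
  (forall n, norm (m (S n) - m n)%P <= k) -> lipschitz k (interpolate m).
Proof.
  intros hm. apply lipschitz_of_le. intros s t hst.
  pose proof (nat_floor_spec s) as hs. pose proof (nat_floor_spec t) as ht.
  destruct (Nat.lt_trichotomy (nat_floor s) (nat_floor t)) as [h|[h|h]].
  - pose proof (interpolate_floor k m t hm) as h1. pose proof (interpolate_ceil k m s hm) as h2.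
    pose proof (steps_le k m _ _ hm h) as h3.
    pose proof (norm_minus_trans (interpolate m t) (m (nat_floor t)) (interpolate m s)).
    pose proof (norm_minus_trans (m (nat_floor t)) (m (S (nat_floor s))) (interpolate m s)).
    lra.
  - unfold interpolate. rewrite h. set (n := nat_floor t) in *.
    replace (m n + (t - INR n)%R * (m (S n) - m n) - (m n + (s - INR n)%R * (m (S n) - m n)))%P
      with ((t - s)%R * (m (S n) - m n))%P by plane_eq.
    rewrite norm_scal_plane, Rabs_right by lra.
    rewrite Rmult_comm. apply Rmult_le_compat_r; [lra|apply hm].
  - apply le_INR in h. rewrite S_INR in h. lra.
Qed.

(** * Evading one lion in continuous time *)

(** Time [t] itself is included here; continuity of the lion paths later yields the strict form. *)
Definition causal (Phi : (R -> plane) -> (R -> plane) -> R -> plane) : Prop :=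
  forall a a' l l' t, 0 <= t -> (forall s, 0 <= s <= t -> a s = a' s /\ l s = l' s) ->
  Phi a l t = Phi a' l' t.

(** [a] is the target and [l] the lion. That [c] depends on neither allows later deviations to be
    fixed in advance. *)
Definition evades (v w d delta c : R) (Phi : (R -> plane) -> (R -> plane) -> R -> plane) :=
  forall a l, lipschitz v a -> lipschitz 1 l -> d <= norm (a 0 - l 0)%P ->
  Phi a l 0 = a 0 /\ lipschitz w (Phi a l) /\
  forall t, 0 <= t -> norm (Phi a l t - a t)%P <= delta /\ c <= norm (Phi a l t - l t)%P.

(** Sampling at multiples of [tau] and dividing by [tau] turns speed bounds into step bounds; the
    discrete answer is interpolated and scaled back. *)
Lemma evader_exists (v w d delta : R) : 1 < w -> 0 <= v < w -> 0 < d -> 0 < delta ->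
  exists c Phi, 0 < c /\ causal Phi /\ evades v w d delta c Phi.
Proof.
  intros hw hv hd hdelta.
  destruct (discrete_evasion w v hw hv) as (r & D & F & hr & hD & Fext & HF).
  (* The first bound makes the scaled initial distance at least [r]; the second covers the discrete
     deviation [D] and the motion of man and target within one cell. *)
  set (tau := Rmin (d / r) (delta / (w + v + D))).
  assert (ht : 0 < tau) by (apply Rmin_pos; apply Rdiv_lt_0_compat; lra).
  assert (htr : r * tau <= d).
  { apply Rle_trans with (r * (d / r)).
    - apply Rmult_le_compat_l; [lra|apply Rmin_l].
    - right. field. lra. }
  assert (htd : (w + v + D) * tau <= delta).
  { apply Rle_trans with ((w + v + D) * (delta / (w + v + D))).
    - apply Rmult_le_compat_l; [lra|apply Rmin_r].
    - right. field. lra. }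
  set (sample := fun (f : R -> plane) n => (/ tau * f (INR n * tau)%R)%P).
  assert (hi : 0 < / tau) by (apply Rinv_0_lt_compat; lra).
  assert (it : tau * / tau = 1) by (apply Rinv_r; lra).
  assert (hsample : forall k f, lipschitz k f ->
    forall n, norm (sample f (S n) - sample f n)%P <= k).
  { intros k f hf n. unfold sample.
    replace (/ tau * f (INR (S n) * tau)%R - / tau * f (INR n * tau)%R)%P
      with (/ tau * (f (INR (S n) * tau)%R - f (INR n * tau)%R))%P by plane_eq.
    rewrite norm_scal_plane, Rabs_right by lra.
    apply Rle_trans with (/ tau * (k * tau)); [|right; field; lra].
    apply Rmult_le_compat_l; [lra|].
    eapply Rle_trans; [apply hf; apply Rmult_le_pos; try apply pos_INR; lra|].
    rewrite S_INR. replace ((INR n + 1) * tau - INR n * tau) with tau by ring.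
    rewrite Rabs_right; lra. }
  (* The clearance at grid times is [2 * (w + 1) * tau], of which man and lion use up at most half
     within a cell. *)
  exists ((w + 1) * tau),
    (fun a l t => tau * interpolate (F (sample a) (sample l)) (t / tau))%P.
  split; [nra|]. split.
  - intros a a' l l' t h0 h.
    assert (htt : 0 <= t / tau) by (apply Rmult_le_pos; lra).
    pose proof (nat_floor_spec _ htt) as [hf _].
    assert (agree : forall k, (k <= nat_floor (t / tau))%nat ->
      sample a k = sample a' k /\ sample l k = sample l' k).
    { intros k hk. apply le_INR in hk. pose proof (pos_INR k). unfold sample.
      destruct (h (INR k * tau)) as [-> ->]; [|tauto].
      split; [apply Rmult_le_pos; lra|].
      replace t with (t / tau * tau) by (field; lra).
      apply Rmult_le_compat_r; lra. }
    f_equal. unfold interpolate.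
    (* Interpolation looks one grid point ahead, but there [F] reads only earlier samples, taken no
       later than [t]. *)
    assert (e : forall n, (n <= S (nat_floor (t / tau)))%nat ->
      F (sample a) (sample l) n = F (sample a') (sample l') n).
    { intros n hn. apply Fext.
      - apply agree. lia.
      - intros k hk. apply agree. lia. }
    rewrite !e by lia. reflexivity.
  - intros a l ha hl h0.
    destruct (HF (sample a) (sample l) (hsample _ _ ha) (hsample _ _ hl)) as [m0 hm].
    { unfold sample. simpl INR. rewrite Rmult_0_l.
      replace (/ tau * a 0 - / tau * l 0)%P with (/ tau * (a 0 - l 0))%P by plane_eq.
      rewrite norm_scal_plane, Rabs_right by lra.
      apply Rmult_le_reg_l with tau; [lra|]. rewrite <- Rmult_assoc, it. lra. }
    set (m := F (sample a) (sample l)) in *.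
    assert (hmw : forall n, norm (m (S n) - m n)%P <= w) by apply hm.
    pose proof (interpolate_lipschitz w m hmw) as hL.
    split; [|split].
    + replace (0 / tau) with 0 by (field; lra). rewrite interpolate_0, m0.
      unfold sample. simpl INR. rewrite Rmult_0_l.
      replace (tau * (/ tau * a 0))%P with ((tau * / tau)%R * a 0)%P by plane_eq.
      rewrite it. plane_eq.
    + intros s t hs hst.
      replace (tau * interpolate m (s / tau) - tau * interpolate m (t / tau))%P
        with (tau * (interpolate m (s / tau) - interpolate m (t / tau)))%P by plane_eq.
      rewrite norm_scal_plane, Rabs_right by lra.
      apply Rle_trans with (tau * (w * Rabs (s / tau - t / tau))).
      * apply Rmult_le_compat_l; [lra|]. apply hL; apply Rmult_le_pos; lra.
      * replace (s / tau - t / tau) with (/ tau * (s - t)) by (field; lra).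
        rewrite Rabs_mult, (Rabs_right (/ tau)) by lra. right. field. lra.
    + intros t hst.
      assert (htt : 0 <= t / tau) by (apply Rmult_le_pos; lra).
      pose proof (nat_floor_spec _ htt) as hf.
      pose proof (interpolate_floor w m _ hmw htt) as h1.
      set (n := nat_floor (t / tau)) in *.
      set (x := interpolate m (t / tau)) in *.
      assert (h2 : norm (tau * x - tau * m n)%P <= w * tau).
      { replace (tau * x - tau * m n)%P with (tau * (x - m n))%P by plane_eq.
        rewrite norm_scal_plane, Rabs_right by lra.
        assert (norm (x - m n)%P <= w) by nra. nra. }
      assert (hnt : INR n * tau <= t <= INR n * tau + tau).
      { replace t with (t / tau * tau) by (field; lra). nra. }
      pose proof (pos_INR n) as hn0.
      assert (hsm : forall k f, 0 <= k -> lipschitz k f ->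
        norm (tau * sample f n - f t)%P <= k * tau).
      { intros k f hk hf'. unfold sample.
        replace (tau * (/ tau * f (INR n * tau)%R))%P with (f (INR n * tau)).
        - eapply Rle_trans; [apply hf'; [apply Rmult_le_pos; lra|lra]|].
          apply Rmult_le_compat_l; [exact hk|]. apply Rabs_le. lra.
        - transitivity ((tau * / tau)%R * f (INR n * tau)%R)%P; [rewrite it|]; plane_eq. }
      destruct (hm n) as (_ & h3 & h4).
      pose proof (hsm v a ltac:(lra) ha) as h5. pose proof (hsm 1 l ltac:(lra) hl) as h6.
      assert (h7 : norm (tau * m n - tau * sample a n)%P <= D * tau).
      { replace (tau * m n - tau * sample a n)%P with (tau * (m n - sample a n))%P by plane_eq.
        rewrite norm_scal_plane, Rabs_right by lra. nra. }
      assert (h8 : 2 * (w + 1) * tau <= norm (tau * m n - tau * sample l n)%P).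
      { replace (tau * m n - tau * sample l n)%P with (tau * (m n - sample l n))%P by plane_eq.
        rewrite norm_scal_plane, Rabs_right by lra. nra. }
      split.
      * pose proof (norm_minus_trans (tau * x)%P (tau * m n)%P (a t)).
        pose proof (norm_minus_trans (tau * m n)%P (tau * sample a n)%P (a t)). lra.
      * pose proof (norm_minus_trans (tau * m n)%P (tau * x)%P (tau * sample l n)%P).
        pose proof (norm_minus_trans (tau * x)%P (l t) (tau * sample l n)%P).
        rewrite (norm_minus_sym (tau * m n)%P (tau * x)%P) in *.
        rewrite (norm_minus_sym (l t)) in *. lra.
Qed.

(** * Limits in the plane *)

(** Being total, it lets the limit strategy be defined before convergence is known. *)
Definition plane_lim (x : nat -> plane) : plane :=
  (real (Lim_seq (fun n => fst (x n))), real (Lim_seq (fun n => snd (x n)))).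

Lemma abs_fst_le (x : plane) : Rabs (fst x) <= norm x.
Proof.
  rewrite norm_dot, <- sqrt_Rsqr_abs. apply sqrt_le_1_alt. unfold Rsqr, dot. nra.
Qed.

Lemma abs_snd_le (x : plane) : Rabs (snd x) <= norm x.
Proof.
  rewrite norm_dot, <- sqrt_Rsqr_abs. apply sqrt_le_1_alt. unfold Rsqr, dot. nra.
Qed.

Lemma norm_le_abs (x : plane) : norm x <= Rabs (fst x) + Rabs (snd x).
Proof.
  replace x with ((fst x, 0) + (0, snd x))%P at 1 by plane_eq.
  eapply Rle_trans; [apply norm_plus_le|].
  rewrite !plane_norm_euclidean. apply Req_le. f_equal.
  - rewrite <- sqrt_Rsqr_abs. f_equal. unfold Rsqr. ring.
  - rewrite <- sqrt_Rsqr_abs. f_equal. unfold Rsqr. ring.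
Qed.

Lemma Lim_seq_near (u : nat -> R) (b : nat -> R) :
  (forall e, 0 < e -> exists n, b n < e) ->
  (forall j k, Rabs (u (j + k)%nat - u j) <= b j) ->
  forall j, Rabs (real (Lim_seq u) - u j) <= b j.
Proof.
  intros hb hu.
  assert (hex : ex_finite_lim_seq u).
  { apply ex_lim_seq_cauchy_corr. intros e. destruct (hb (e / 2)) as [N hN].
    - destruct e; simpl; lra.
    - exists N. intros n m hn hm.
      pose proof (hu N (n - N)%nat) as h1. pose proof (hu N (m - N)%nat) as h2.
      replace (N + (n - N))%nat with n in h1 by lia.
      replace (N + (m - N))%nat with m in h2 by lia.
      apply Rabs_le_between in h1. apply Rabs_le_between in h2.
      apply Rabs_def1; lra. }
  apply Lim_seq_correct' in hex. intros j.
  apply (is_lim_seq_incr_n u j) in hex.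
  apply Rabs_le_between'. split.
  - apply (is_lim_seq_le (fun _ => u j - b j) (fun n => u (n + j)%nat)
      (u j - b j) (real (Lim_seq u))); [|apply is_lim_seq_const|exact hex].
    intros n. specialize (hu j n). apply Rabs_le_between in hu. rewrite Nat.add_comm. lra.
  - apply (is_lim_seq_le (fun n => u (n + j)%nat) (fun _ => u j + b j)
      (real (Lim_seq u)) (u j + b j)); [|exact hex|apply is_lim_seq_const].
    intros n. specialize (hu j n). apply Rabs_le_between in hu. rewrite Nat.add_comm. lra.
Qed.

(** The factor 2 comes from estimating the two coordinates separately. *)
Lemma plane_lim_near (x : nat -> plane) (b : nat -> R) :
  (forall e, 0 < e -> exists n, b n < e) ->
  (forall j k, norm (x (j + k)%nat - x j)%P <= b j) ->
  forall j, norm (plane_lim x - x j)%P <= 2 * b j.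
Proof.
  intros hb hx j. eapply Rle_trans; [apply norm_le_abs|].
  pose proof (Lim_seq_near (fun n => fst (x n)) b hb
    (fun j k => Rle_trans _ _ _ (abs_fst_le (x (j + k)%nat - x j)%P) (hx j k)) j) as h1.
  pose proof (Lim_seq_near (fun n => snd (x n)) b hb
    (fun j k => Rle_trans _ _ _ (abs_snd_le (x (j + k)%nat - x j)%P) (hx j k)) j) as h2.
  cbn in h1, h2 |- *. unfold Rminus in h1, h2. lra.
Qed.

(** [4 / 3] is the sum of the geometric series with ratio [1 / 4]. *)
Lemma geometric_tail (x : nat -> plane) (b : nat -> R) :
  (forall j, norm (x (S j) - x j)%P <= b j) -> (forall j, 0 <= b (S j) <= b j / 4) ->
  forall k j, norm (x (j + k)%nat - x j)%P <= 4 / 3 * b j.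
Proof.
  intros hx hb. induction k as [|k IH]; intros j.
  - rewrite Nat.add_0_r, norm_minus_self. specialize (hb j). lra.
  - rewrite Nat.add_succ_r. change (S (j + k)) with (S j + k)%nat.
    pose proof (norm_minus_trans (x (S j + k)%nat) (x (S j)) (x j)).
    specialize (IH (S j)). specialize (hx j). specialize (hb j). lra.
Qed.

(** * Infinitely many lions *)

Lemma evasion_limit (eps : R) (m0 : plane) (d : nat -> R) :
  0 < eps -> (forall i, 0 < d i) ->
  exists M : (nat -> R -> plane) -> R -> plane,
  (forall l l' t, 0 <= t -> (forall i s, 0 <= s <= t -> l i s = l' i s) ->
    M l t = M l' t) /\
  forall l : nat -> R -> plane,
    (forall i, lipschitz 1 (l i)) -> (forall i, d i <= norm (m0 - l i 0)%P) ->
    M l 0 = m0 /\ lipschitz (1 + eps) (M l) /\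
    forall i t, 0 <= t -> M l t <> l i t.
Proof.
  intros heps hd.
  (* Evaders for all parameters are chosen at once, because each [delta] depends on the clearance of
     the preceding evader. *)
  destruct (functional_choice
    (fun (p : R * R * R * R)
         (q : R * ((R -> plane) -> (R -> plane) -> R -> plane)) =>
      let '(v, w, d, delta) := p in
      1 < w -> 0 <= v < w -> 0 < d -> 0 < delta ->
      0 < fst q /\ causal (snd q) /\ evades v w d delta (fst q) (snd q)))
    as [ev hev].
  { intros [[[v w] d'] delta].
    destruct (Rlt_dec 1 w); [|exists (0, fun _ _ _ => m0); tauto].
    destruct (Rle_dec 0 v); [|exists (0, fun _ _ _ => m0); tauto].
    destruct (Rlt_dec v w); [|exists (0, fun _ _ _ => m0); tauto].
    destruct (Rlt_dec 0 d'); [|exists (0, fun _ _ _ => m0); tauto].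
    destruct (Rlt_dec 0 delta); [|exists (0, fun _ _ _ => m0); tauto].
    destruct (evader_exists v w d' delta) as (c & Phi & h); auto.
    exists (c, Phi). auto. }
  (* The speeds increase strictly from [1 + eps / 2] and stay below [1 + eps], so every stage is
     faster than its target. *)
  set (v := fun j => 1 + eps * (1 - (/ 2) ^ S j)).
  set (par := fun (j : nat) (delta : R) => (v j, v (S j), d j, delta)).
  (* A quarter of the last [delta] makes the deviations summable; a quarter of the last clearance
     keeps their total below it. *)
  set (delta := fix delta (j : nat) : R := match j with
    | O => 1
    | S k => Rmin (delta k) (fst (ev (par k (delta k)))) / 4
    end).
  set (c := fun j => fst (ev (par j (delta j)))).
  set (Phi := fun j => snd (ev (par j (delta j)))).
  assert (hv : forall j, 1 < v j < v (S j) /\ v j <= 1 + eps).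
  { intros j. unfold v. assert (0 < (/ 2) ^ S j) by (apply pow_lt; lra).
    assert ((/ 2) ^ S j <= 1 / 2).
    { simpl. assert ((/ 2) ^ j <= 1 ^ j) by (apply pow_incr; lra). rewrite pow1 in *. lra. }
    change ((/ 2) ^ S (S j)) with (/ 2 * (/ 2) ^ S j). nra. }
  assert (hstage : forall j, 0 < delta j ->
    0 < c j /\ causal (Phi j) /\ evades (v j) (v (S j)) (d j) (delta j) (c j) (Phi j)).
  { intros j hj. destruct (hv j) as [? _]. apply (hev (par j (delta j))); auto; lra. }
  assert (hdelta : forall j, 0 < delta j).
  { induction j as [|j IH]; [simpl; lra|]. destruct (hstage j IH) as [h _].
    change (0 < Rmin (delta j) (c j) / 4). pose proof (Rmin_pos _ _ IH h). lra. }
  assert (hdS : forall j, delta (S j) <= delta j / 4 /\ delta (S j) <= c j / 4).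
  { intros j. change (delta (S j)) with (Rmin (delta j) (c j) / 4).
    pose proof (Rmin_l (delta j) (c j)). pose proof (Rmin_r (delta j) (c j)). lra. }
  assert (hsmall : forall e, 0 < e -> exists n, 4 / 3 * delta n < e).
  { intros e he. destruct (pow_lt_1_zero (/ 4)) with (y := e / 2) as [n hn].
    - rewrite Rabs_right; lra.
    - lra.
    - exists n. specialize (hn n (le_n n)). rewrite Rabs_right in hn.
      + assert (delta n <= (/ 4) ^ n); [|lra]. clear hn.
        induction n as [|n IH]; simpl pow; [simpl; lra|]. destruct (hdS n). lra.
      + apply Rle_ge, pow_le. lra. }
  set (stage := fun l : nat -> R -> plane => fix stage (j : nat) : R -> plane := match j with
    | O => fun _ => m0
    | S k => Phi k (stage k) (l k)
    end).
  exists (fun l t => plane_lim (fun j => stage l j t)). split.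
  - intros l l' t ht h.
    assert (e : forall j s, 0 <= s <= t -> stage l j s = stage l' j s).
    { induction j as [|j IH]; intros s hs; [reflexivity|].
      destruct (hstage j (hdelta j)) as (_ & hc & _). apply hc; [lra|].
      intros s' hs'. split; [apply IH|apply h]; lra. }
    unfold plane_lim.
    f_equal; f_equal; apply Lim_seq_ext; intros n; rewrite e by lra; reflexivity.
  - intros l hl hl0.
    assert (hs : forall j, stage l j 0 = m0 /\ lipschitz (v j) (stage l j)).
    { induction j as [|j [IH0 IH1]].
      - split; [reflexivity|]. intros s t _ _. simpl. rewrite norm_minus_self.
        destruct (hv O). apply Rmult_le_pos; [lra|apply Rabs_pos].
      - destruct (hstage j (hdelta j)) as (_ & _ & he).
        destruct (he (stage l j) (l j)) as (h1 & h2 & _); auto.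
        + rewrite IH0. apply hl0.
        + split; [simpl; rewrite h1; exact IH0|exact h2]. }
    assert (hstep : forall j t, 0 <= t ->
      norm (stage l (S j) t - stage l j t)%P <= delta j /\
      c j <= norm (stage l (S j) t - l j t)%P).
    { intros j. destruct (hstage j (hdelta j)) as (_ & _ & he). destruct (hs j) as [h1 h2].
      destruct (he (stage l j) (l j)) as (_ & _ & h); auto. rewrite h1. apply hl0. }
    assert (hnear : forall t, 0 <= t -> forall j,
      norm (plane_lim (fun j => stage l j t) - stage l j t)%P <= 2 * (4 / 3 * delta j)).
    { intros t ht. apply (plane_lim_near (fun j => stage l j t)); [exact hsmall|].
      intros j k. apply (geometric_tail (fun j => stage l j t) delta).
      - intros i. apply hstep, ht.
      - intros i. split; [apply Rlt_le, hdelta|apply hdS]. }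
    split; [|split].
    + unfold plane_lim.
      rewrite (Lim_seq_ext _ (fun _ => fst m0)) by (intros j; rewrite (proj1 (hs j)); reflexivity).
      rewrite (Lim_seq_ext (fun n => snd _) (fun _ => snd m0))
        by (intros j; rewrite (proj1 (hs j)); reflexivity).
      rewrite !Lim_seq_const. destruct m0; reflexivity.
    (* Replacing the limit by stage [j] costs at most [e / 2] at each of the two times. *)
    + intros s t hs' ht. apply le_epsilon. intros e he.
      destruct (hsmall (e / 4)) as [j hj]; [lra|].
      pose proof (hnear s hs' j). pose proof (hnear t ht j) as h2.
      set (X := plane_lim (fun j => stage l j s)) in *.
      set (Y := plane_lim (fun j => stage l j t)) in *.
      rewrite norm_minus_sym in h2.
      pose proof (norm_minus_trans X (stage l j s) Y).
      pose proof (norm_minus_trans (stage l j s) (stage l j t) Y).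
      pose proof (proj2 (hs j) s t hs' ht).
      assert (v j * Rabs (s - t) <= (1 + eps) * Rabs (s - t)).
      { apply Rmult_le_compat_r; [apply Rabs_pos|apply hv]. }
      lra.
    (* If the limit met lion [i], stage [S i] would be within [8 / 3 * delta (S i) <= 2 / 3 * c i]
       of it, contrary to its clearance [c i]. *)
    + intros i t ht hit. pose proof (hnear t ht (S i)) as h1.
      destruct (hstep i t ht) as [_ h2]. rewrite hit, norm_minus_sym in h1.
      destruct (hdS i) as [_ h3]. destruct (hstage i (hdelta i)) as [h4 _]. lra.
Qed.

(** * From functions on the reals to paths and strategies *)

Definition clamp (t : R) : nonnegreal := mknonnegreal (Rmax 0 t) (Rmax_l 0 t).

(** Equal times may carry different proofs of nonnegativity; the speed bound still identifies the
    positions. *)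
Lemma path_eq (k : R) (x : plane) (f : path k x) (s t : nonnegreal) :
  nonneg s = nonneg t -> f s = f t.
Proof.
  intros h. apply norm_minus_eq0. eapply Rle_trans; [apply path_speed|].
  rewrite h. rewrite Rminus_diag, Rabs_R0. lra.
Qed.

Lemma path_lipschitz (k : R) (x : plane) (f : path k x) : lipschitz k (fun t => f (clamp t)).
Proof.
  intros s t hs ht. eapply Rle_trans; [apply path_speed|].
  simpl. rewrite !Rmax_right by assumption. lra.
Qed.

(** Continuity carries the agreement to [t] itself; at time 0 the common starting point does. *)
Lemma lion_paths_agree (p : plane) (f g : lion_path p) (t : nonnegreal) :
  (forall s : nonnegreal, s < t -> f s = g s) -> f t = g t.
Proof.
  intros h. destruct (Rle_lt_or_eq_dec 0 t (cond_nonneg t)) as [h0|h0].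
  - apply norm_minus_eq0. apply le_epsilon. intros e he.
    set (s := clamp (Rmax 0 (t - e / 2))).
    assert (hs : t - e / 2 <= s /\ s < t).
    { simpl. rewrite (Rmax_right 0 (Rmax 0 _)) by apply Rmax_l.
      split; [apply Rmax_r|]. apply Rmax_lub_lt; lra. }
    pose proof (path_speed f t s) as h1. pose proof (path_speed g s t) as h2.
    pose proof (norm_minus_trans (f t) (f s) (g t)) as h3.
    rewrite (h s) in h3 at 2 by apply hs.
    rewrite Rabs_right in h1 by lra. rewrite Rabs_left in h2 by lra. lra.
  - rewrite (path_eq _ _ f t time0), (path_eq _ _ g t time0) by (simpl; auto).
    rewrite !path_start. reflexivity.
Qed.

Theorem theorem1 (eps : R) (m0 : plane) (p : nat -> plane)
    (heps : 0 < eps) (hp : forall i : nat, p i <> m0) :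
  exists M : strategy eps m0 p, winning M.
Proof.
  destruct (evasion_limit eps m0 (fun i => norm (m0 - p i)%P) heps) as (F & Fext & HF).
  { intros i. destruct (Rle_lt_dec (norm (m0 - p i)%P) 0) as [h|h]; [|exact h].
    apply norm_minus_eq0 in h. destruct (hp i). auto. }
  set (ext := fun (l : forall i, lion_path (p i)) i t => l i (clamp t)).
  assert (hext : forall l, F (ext l) 0 = m0 /\ lipschitz (1 + eps) (F (ext l)) /\
    forall i t, 0 <= t -> F (ext l) t <> ext l i t).
  { intros l. apply HF.
    - intros i. apply path_lipschitz.
    - intros i. unfold ext.
      rewrite (path_eq _ _ (l i) (clamp 0) time0), path_start; [lra|].
      simpl. apply Rmax_left. lra. }
  set (response := fun l => @Path (1 + eps) m0 (fun t : nonnegreal => F (ext l) t)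
    (proj1 (hext l))
    (fun s t => proj1 (proj2 (hext l)) s t (cond_nonneg s) (cond_nonneg t))).
  assert (hna : non_anticipating response).
  { intros t l l' h s hs. apply Fext; [apply cond_nonneg|].
    (* [F] may read the lions at time [t] itself, while agreement is given only before [t]. *)
    intros i r hr. apply lion_paths_agree. intros r' hr'. apply h.
    simpl in hr'. rewrite Rmax_right in hr' by lra. lra. }
  exists (Strategy hna). intros l t i hit.
  apply (proj2 (proj2 (hext l)) i t (cond_nonneg t)).
  simpl in hit. rewrite hit. unfold ext. apply path_eq.
  simpl. rewrite Rmax_right; [reflexivity|apply cond_nonneg].
Qed.
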